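(* The following decision problem is algorithmically unsolvable: given a univariate arithmetic term $t(m)$, decide whether there exists $m \in \mathbb{N}$ such that $t(m) = 0$.
   Context: $\mathbb{N}=\{0,1,2,\dots\}$. An arithmetic term is a finite expression built from variables ranging over $\mathbb{N}$ and natural-number constants by composing the operations addition $x+y$, truncated subtraction $x \dot{-} y=\max(x-y,0)$, multiplication $xy$, integer division $\lfloor x/y\rfloor$, remainder $x \bmod y$, and exponentiation $x^y$. Conventions: $x \bmod 0 = x$, and, for definiteness, $\lfloor x/0\rfloor=0$ and $0^0=1$. Univariate means that at most one variable occurs. *)

(* Defs.v *)
From mathcomp Require Import all_boot.

Set Implicit Arguments.
Unset Strict Implicit.
Unset Printing Implicit Defensive.

Inductive aop := Add | Sub | Mul | Div | Mod | Pow.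

Inductive aterm :=
| Var of nat
| Cst of nat
| Bin of aop & aterm & aterm.

(* The ssrnat operations follow the intended conventions: [-] is truncated,
   [x %/ 0 = 0], [x %% 0 = x] and [0 ^ 0 = 1]; see [aop_conventions]. *)
Definition aop_eval (o : aop) (x y : nat) : nat :=
  match o with
  | Add => x + y
  | Sub => x - y
  | Mul => x * y
  | Div => x %/ y
  | Mod => x %% y
  | Pow => x ^ y
  end.

Lemma aop_conventions (x y : nat) :
  [/\ aop_eval Sub x (x + y) = 0, aop_eval Div x 0 = 0,
      aop_eval Mod x 0 = x & aop_eval Pow 0 0 = 1].
Proof. by split; rewrite /= ?divn0 ?modn0 //; apply/eqP/leq_addr. Qed.

Fixpoint aeval (env : nat -> nat) (t : aterm) : nat :=
  match t with
  | Var i => env i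
  | Cst c => c
  | Bin o a b => aop_eval o (aeval env a) (aeval env b)
  end.

Fixpoint avars (t : aterm) : seq nat :=
  match t with
  | Var i => [:: i]
  | Cst _ => [::]
  | Bin _ a b => avars a ++ avars b
  end.

Definition univariate (t : aterm) : bool := size (undup (avars t)) <= 1.

(* The value [t(m)] of a univariate term: whichever variable occurs in [t] is
   assigned [m]. *)
Definition aeval1 (t : aterm) (m : nat) : nat := aeval (fun=> m) t.

(* Cantor's pairing bijection. *)
Definition cpair (x y : nat) : nat := ((x + y) * (x + y).+1)./2 + y.

Definition aop_code (o : aop) : nat :=
  match o with
  | Add => 2 | Sub => 3 | Mul => 4 | Div => 5 | Mod => 6 | Pow => 7
  end.

(* Goedel number of a term: the form in which a term is given to an algorithm. *)
Fixpoint aterm_code (t : aterm) : nat :=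
  match t with
  | Var i => cpair 0 i
  | Cst c => cpair 1 c
  | Bin o a b => cpair (aop_code o) (cpair (aterm_code a) (aterm_code b))
  end.

Lemma cpair_inj (x y x' y' : nat) : cpair x y = cpair x' y' -> x = x' /\ y = y'.
Proof.
have step s s' z z' : z <= s -> s < s' ->
    (s * s.+1)./2 + z < (s' * s'.+1)./2 + z'.
  move=> zs ss'; apply: (@leq_trans (s.+1 * s.+2)./2); last first.
    by apply: leq_trans (leq_addr _ _); apply: half_leq; apply: leq_mul.
  have -> : s.+1 * s.+2 = s * s.+1 + s.+1.*2.
    by rewrite -addn2 mulnDr muln2 mulnC.
  by rewrite halfD odd_double andbF add0n doubleK ltn_add2l ltnS.
rewrite /cpair => e.
have es : x + y = x' + y'.
  have [lt|lt|//] := ltngtP (x + y) (x' + y').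
    by have := step _ _ y y' (leq_addl _ _) lt; rewrite e ltnn.
  by have := step _ _ y' y (leq_addl _ _) lt; rewrite e ltnn.
move: e; rewrite es => /addnI ey; split=> //.
by move: es; rewrite ey => /addIn.
Qed.

Lemma aterm_code_inj : injective aterm_code.
Proof.
elim=> [i|c|o a IHa b IHb] [i'|c'|o' a' b'] /= /cpair_inj [e1 e2].
- by rewrite e2.
- by [].
- by case: o' e1.
- by [].
- by rewrite e2.
- by case: o' e1.
- by case: o e1.
- by case: o e1.
have [/IHa -> /IHb ->] := cpair_inj e2.
by congr Bin; case: o o' e1 => [] [].
Qed.

(* Kleene's partial recursive functions, indexed by their arity. *)
Inductive recfun : nat -> Type :=
| RZero n : recfun n
| RSucc : recfun 1
| RProj n (i : 'I_n) : recfun n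
| RComp m n (f : recfun m) (g : 'I_m -> recfun n) : recfun n
| RPrim n (f : recfun n) (g : recfun n.+2) : recfun n.+1
| RMin n (f : recfun n.+1) : recfun n.

Fixpoint primrec_graph (base : nat -> Prop) (step : nat -> nat -> nat -> Prop)
    (k y : nat) : Prop :=
  match k with
  | 0 => base y
  | k'.+1 => exists2 r, primrec_graph base step k' r & step k' r y
  end.

(* [reval f v y]: the partial function [f] is defined at [v], with value [y].
   Primitive recursion is on the first argument,
     h(0, v) = f(v),   h(k+1, v) = g(k, h(k, v), v),
   and minimization is also on the first argument; it requires [f(z, v)] to be
   defined for every [z] below the result. *)
Fixpoint reval n (f : recfun n) : n.-tuple nat -> nat -> Prop :=
  match f in recfun n return n.-tuple nat -> nat -> Prop with
  | RZero _ => fun _ y => y = 0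
  | RSucc => fun v y => y = (thead v).+1
  | RProj _ i => fun v y => y = tnth v i
  | RComp m _ f g => fun v y =>
      exists2 w : m.-tuple nat, forall i, reval (g i) v (tnth w i) & reval f w y
  | RPrim _ f g => fun v y =>
      primrec_graph (reval f (behead_tuple v))
        (fun k r => reval g (cons_tuple k (cons_tuple r (behead_tuple v))))
        (thead v) y
  | RMin _ f => fun v y =>
      reval f (cons_tuple y v) 0 /\
      forall z, z < y -> exists r, reval f (cons_tuple z v) r.+1
  end.

Lemma reval_functional n (f : recfun n) (v : n.-tuple nat) (y y' : nat) :
  reval f v y -> reval f v y' -> y = y'.
Proof.
elim: f v y y' => {n} /=.
- by move=> n v y y' -> ->.
- by move=> v y y' -> ->.
- by move=> n i v y y' -> ->.
- move=> m n f IHf g IHg v y y' [w gw fw] [w' gw' fw'].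
  have ww' : w = w' by apply: eq_from_tnth => i; apply: IHg (gw i) (gw' i).
  by rewrite -ww' in fw'; apply: IHf fw fw'.
- move=> n f IHf g IHg v; elim: (thead v) => [|k IHk] y y' /=; first exact: IHf.
  move=> [r kr gr] [r' kr' gr'].
  by rewrite -(IHk _ _ kr kr') in gr'; apply: IHg gr gr'.
- move=> n f IHf v y y' [fy ly] [fy' ly'].
  have [lt|lt|//] := ltngtP y y'.
    by have [r fr] := ly' _ lt; have := IHf _ _ _ fy fr.
  by have [r fr] := ly _ lt; have := IHf _ _ _ fy' fr.
Qed.

(* The problem "given an instance [t] satisfying [inst], decide whether [Q t]"
   is solved by some algorithm, instances being presented through [code]. Nothing
   is required of the algorithm on other inputs, not even termination. *)
Definition algorithmically_solvable (T : Type) (code : T -> nat)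
    (inst Q : T -> Prop) : Prop :=
  exists f : recfun 1, forall t : T, inst t ->
    (Q t -> reval f [tuple code t] 1) /\ (~ Q t -> reval f [tuple code t] 0).

(* Main.v *)
(* Suppose an algorithm decides the problem, and let [t<k>] be the term
   [t + |L - k|], where [L] is a fixed term of which every number is a value. The set
   of all [k = code t] such that [t<k>] has no zero is then recursively enumerable,
   so it is the set of all [k] such that [u(m) = 0] and [L(m) = k] for some [m], for a
   suitable univariate term [u]; taking [t = u] and [k = code u] is contradictory.
   Since [code t<k>] is itself an arithmetic term in [code t], the diagonalization
   needs no computation on syntax.

   That recursively enumerable sets are definable by terms is shown in three steps.
   A recursive function is computed by a nondeterministic register program built from
   affine assignments and tests, sequence and iteration; a stack of pending
   subprograms, written as a number in a large base, turns the program into a single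
   finite set of affine transition rules. A run of [T] steps is described in the style
   of Jones and Matiyasevich: writing sequences of length [T] as numbers in a large
   base [X], the transitions become linear equations between the numbers [S i] (when
   is rule [i] used?) and [V i j] (with which parameters?), whose shapes are enforced
   by bitwise inclusions. By Lucas' theorem, inclusion of the bits of [a] in those of
   [b] means that the binomial coefficient ['C(b, a)] is odd, and that parity is a term.

   Finally, all unknowns are read off a single variable. For
   [m = 2^i * (2^(2^l) - 1)] with [0 < i <= 2^l], the remainder of [2^(m^m)] by [m] is
   [2^(2^l)], and the logarithm of a power of two [z] is a term because
   [z^n = (1 + q)^(lg z) = 1 + q * lg z] modulo [q^2], where [q = 2^n - 1]. *)
From HB Require Import structures.
Require Import Defs.
From mathcomp Require Import all_boot.
From mathcomp Require Import zify.

Set Implicit Arguments.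
Unset Strict Implicit.
Unset Printing Implicit Defensive.

(** * Bitwise inclusion and pairing by arithmetic terms *)

Definition bitsub (a b : nat) : bool := odd 'C(b, a).

(** Pascal's rule modulo 2 carries the pattern from rows [n.*2] and [n.*2.+1] to the next two; this
    is the one-digit case of Lucas' theorem. *)
Lemma odd_bin_double n k :
  [/\ odd 'C(n.*2, k.*2) = odd 'C(n, k), odd 'C(n.*2, k.*2.+1) = false,
      odd 'C(n.*2.+1, k.*2) = odd 'C(n, k) &
      odd 'C(n.*2.+1, k.*2.+1) = odd 'C(n, k)].
Proof.
elim: n k => [|n IHn] k.
  by case: k => [|k]; rewrite ?doubleS !bin0n ?binS ?bin0n.
have even l : odd 'C(n.+1.*2, l.*2) = odd 'C(n.+1, l).
  case: l => [|l]; first by rewrite !bin0.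
  have [h1 _ _ _] := IHn l.+1; have [h2 h3 _ _] := IHn l.
  rewrite doubleS in h1.
  by rewrite !doubleS !binS !oddD h1 h2 h3 addbF.
have odd_ l : odd 'C(n.+1.*2, l.*2.+1) = false.
  rewrite doubleS binS oddD.
  have [_ _ h3 h4] := IHn l.
  by rewrite h4 h3 addbb.
split=> //.
  case: k => [|k]; first by rewrite !bin0.
  by rewrite (doubleS k) binS oddD -doubleS even odd_ addbF.
by rewrite binS oddD even odd_ addFb.
Qed.

Lemma bitsub_double (b0 a0 : bool) b a :
  bitsub (a0 + a.*2) (b0 + b.*2) = bitsub a0 b0 && bitsub a b.
Proof.
have [h1 h2 h3 h4] := odd_bin_double b a.
by rewrite /bitsub; case: a0 b0 => [] [] /=; rewrite ?add0n ?add1n ?h1 ?h2 ?h3 ?h4.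
Qed.

(** The size bounds keep the low blocks from overlapping the high ones, so inclusion can be tested
    one digit in base [2 ^ n] at a time. *)
Lemma bitsub_block n a0 b0 a b : a0 < 2 ^ n -> b0 < 2 ^ n ->
  bitsub (a0 + 2 ^ n * a) (b0 + 2 ^ n * b) = bitsub a0 b0 && bitsub a b.
Proof.
elim: n a0 b0 => [|n IHn] a0 b0; first by case: a0 b0 => [] // [] // _ _; rewrite !mul1n.
have half_lt c : c < 2 ^ n.+1 -> c./2 < 2 ^ n.
  by rewrite expnS mul2n -{1}(odd_double_half c) => h; lia.
move=> /half_lt la /half_lt lb.
have split c d : c + 2 ^ n.+1 * d = odd c + (c./2 + 2 ^ n * d).*2.
  by rewrite -{1}(odd_double_half c) expnS -mulnA mul2n doubleD addnA.
rewrite !split bitsub_double IHn // andbA -bitsub_double.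
by rewrite !odd_double_half.
Qed.

Lemma bitsub0r a : bitsub a 0 = (a == 0).
Proof. by rewrite /bitsub bin0n oddb. Qed.

Lemma bitsub_pred_exp2 n a : bitsub a (2 ^ n - 1) = (a < 2 ^ n).
Proof.
elim: n a => [|n IHn] a; first by rewrite subnn bitsub0r ltnS leqn0.
have -> : 2 ^ n.+1 - 1 = true + (2 ^ n - 1).*2.
  by rewrite expnS; have := expn_gt0 2 n; lia.
rewrite -{1}(odd_double_half a) bitsub_double IHn expnS.
have -> : bitsub (odd a) true by case: (odd a).
by rewrite -{2}(odd_double_half a) /= mul2n; case: (odd a); lia.
Qed.

Definition repunit X T := \sum_(i < T) X ^ i.

Lemma repunitS X T : repunit X T.+1 = 1 + X * repunit X T.
Proof.
rewrite /repunit big_ord_recl expn0 big_distrr; congr (_ + _).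
by apply: eq_bigr => i _; rewrite expnS.
Qed.

Lemma repunitE X T : 1 < X -> repunit X T = (X ^ T - 1) %/ (X - 1).
Proof. by move=> X1; rewrite !subn1 predn_exp mulKn //; case: X X1 => [|[]]. Qed.

(** By the binomial theorem the digits of [Y.+1 ^ n] in base [Y] are the coefficients ['C(n, j)],
    all at most [2 ^ n < Y]. Dividing by [Y ^ k] brings digit [k] to the units place, and as [Y] is
    even the parity is that of this digit. *)
Lemma parity_binE n k :
  let Y := 2 ^ n.+1 in ((Y.+1 ^ n) %/ Y ^ k) %% 2 = odd 'C(n, k).
Proof.
move=> Y; have Y0 : 0 < Y by rewrite expn_gt0.
have binY j : 'C(n, j) < Y.
  apply: (@leq_ltn_trans (2 ^ n)); last by rewrite ltn_exp2l.
  have [lj|lj] := leqP j n; last by rewrite bin_small.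
  rewrite -[2]/(1 + 1) expnDn (bigD1 (inord j)) //= inordK //.
  by rewrite !exp1n !muln1 leq_addr.
have low (l : nat) : \sum_(j < l) 'C(n, j) * Y ^ j < Y ^ l.
  elim: l => [|l IHl]; first by rewrite big_ord0.
  rewrite big_ord_recr /= expnS.
  apply: (@leq_trans (Y ^ l + 'C(n, l) * Y ^ l)); first by rewrite ltn_add2r.
  by rewrite -mulSn leq_mul2r binY orbT.
(* The sum is padded with zero coefficients so that it can be cut at [k] even when [k > n]. *)
have -> : Y.+1 ^ n = \sum_(j < n.+1 + k.+1) 'C(n, j) * Y ^ j.
  rewrite -addn1 addnC expnDn big_split_ord /= [X in _ = _ + X]big1 ?addn0.
    by apply: eq_bigr => j _; rewrite exp1n mul1n.
  by move=> j _; rewrite bin_small //= addSn ltnS leq_addr.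
rewrite addnC addSnnS big_split_ord /= divnDr; last first.
  by apply: dvdn_sum => j _; rewrite expnD mulnCA dvdn_mulr.
rewrite divn_small ?low // add0n big_ord_recl /= addn0 divnDl ?dvdn_mull //.
rewrite mulnK ?expn_gt0 ?Y0 //.
rewrite (eq_bigr (fun j : 'I_n.+1 => Y ^ k * (Y * (Y ^ j * 'C(n, k + j.+1))))); last first.
  by move=> j _; rewrite /= /bump /= add1n expnD expnS; set c := binomial _ _; nia.
rewrite -!big_distrr mulKn ?expn_gt0 ?Y0 //= -modnDmr.
by rewrite {1}/Y expnS -mulnA -modnMml modnn mul0n mod0n addn0 modn2.
Qed.

(** * Logarithms of powers of two, and two numbers read off a single one *)

Definition lg z := (z ^ z %% (2 ^ z - 1) ^ 2 - 1) %/ (2 ^ z - 1).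

Lemma expS_mod_sqr q a : q.+1 ^ a = 1 + a * q %[mod q ^ 2].
Proof.
elim: a => // a IHa; rewrite expnS -modnMmr IHa modnMmr.
by rewrite (_ : q.+1 * _ = a * q ^ 2 + (1 + a.+1 * q)) ?modnMDl //; lia.
Qed.

(** Raising [z] to the power [z] makes [q = 2 ^ z - 1] large enough for [1 + a * q < q ^ 2] when
    [a > 0], so that the remainder is exact; [a = 0] is settled by computation. *)
Lemma lg_exp2 a : lg (2 ^ a) = a.
Proof.
case: a => // a; rewrite /lg; set z := 2 ^ a.+1; set q := 2 ^ z - 1.
have az : a.+1 < z by apply: ltn_expl.
have zq : z < 2 ^ z by apply: ltn_expl.
have -> : z ^ z = q.+1 ^ a.+1.
  by rewrite {1}/z -expnM mulnC expnM; congr (_ ^ _); rewrite /q; lia.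
rewrite expS_mod_sqr modn_small; last first.
  apply: (@leq_trans (q + a.+1 * q)); first by rewrite /q; lia.
  by rewrite -mulSn -mulnn leq_mul2r; apply/orP; right; rewrite /q; lia.
by rewrite addKn mulnK // /q; lia.
Qed.

Definition pow2part m := 2 ^ (m ^ m) %% m.
Definition fst_arg m := lg (m %/ (pow2part m - 1)).
Definition left_arg m := fst_arg m - 1.
Definition right_arg m := lg (lg (pow2part m)) - fst_arg m.

Lemma args_surj x y : exists m, left_arg m = x /\ right_arg m = y.
Proof.
(* [i] must be positive, hence the shift undone in [left_arg]; taking [l = y + i] ensures
   [i <= 2 ^ l] and lets [right_arg] recover [y] as [l - i]. *)
pose i := x.+1; pose l := y + i; pose j := 2 ^ l.
pose m := 2 ^ i * (2 ^ j - 1).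
have lj : l < j by apply: ltn_expl.
have jj : j < 2 ^ j by apply: ltn_expl.
have ij : i <= j by rewrite /l in lj; lia.
have j2 : 2 <= j by rewrite /l /i in lj *; lia.
have i1 : 2 <= 2 ^ i by rewrite /i expnS; have := expn_gt0 2 x; lia.
have jm : 2 ^ j < m.
  apply: (@leq_trans (2 * (2 ^ j - 1))); last by rewrite leq_mul2r i1 orbT.
  have : 2 ^ 2 <= 2 ^ j by rewrite leq_exp2l.
  by rewrite (_ : 2 ^ 2 = 4) //; lia.
have m0 : 0 < m by lia.
have /dvdnP[h hE] : j %| m ^ m.
  rewrite /m expnMn -expnM; apply: dvdn_mulr; rewrite dvdn_exp2l //.
  by apply: (@leq_trans (1 * m)); [lia | rewrite leq_mul2r /i orbT].
have h0 : 0 < h by have := expn_gt0 m m; rewrite m0 hE; case: (h).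
have eE : pow2part m = 2 ^ j.
  rewrite /pow2part -[RHS](modn_small jm); apply/eqP.
  (* The difference from [2 ^ j] is [2 ^ j * ((2 ^ j) ^ h.-1 - 1)], where [2 ^ i] divides the first
     factor and [2 ^ j - 1] the second. *)
  have -> : 2 ^ (m ^ m) = 2 ^ j * (2 ^ j) ^ h.-1.
    by rewrite -expnS prednK // hE mulnC expnM.
  rewrite eqn_mod_dvd; last by rewrite leq_pmulr // !expn_gt0.
  rewrite -[X in _ - X]muln1 -mulnBr; apply: dvdn_mul; first exact: dvdn_exp2l.
  by rewrite !subn1 (predn_exp (2 ^ j)) dvdn_mulr.
have fE : fst_arg m = i.
  by rewrite /fst_arg eE /m mulnK ?lg_exp2 //; lia.
by exists m; rewrite /left_arg /right_arg fE eE !lg_exp2 /l /i; split; lia.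
Qed.

(** * Runs of affine transition systems *)

(* [(a, j, b)] stands for the affine form [d |-> a * d j + b]. *)
Definition form : Type := (nat * nat * nat)%type.
Definition ev (p : form) (d : nat -> nat) := p.1.1 * d p.1.2 + p.2.

Lemma low_digit X a a' b b' : a < X -> a' < X ->
  a + X * b = a' + X * b' -> a = a' /\ b = b'.
Proof.
move=> lt lt' E; have X0 : 0 < X by apply: leq_ltn_trans lt.
have md x y : x < X -> (x + X * y) %% X = x.
  by move=> h; rewrite addnC mulnC modnMDl modn_small.
have E1 : a = a' by rewrite -(md a b lt) E md.
by split=> //; move: E; rewrite E1 => /addnI/eqP; rewrite eqn_pmul2l // => /eqP.
Qed.

Section Linear.

Variables (K R : nat) (src dst : nat -> nat -> form).

(** The parameters [d] have to match the old state through the source forms: a rule both reads and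
    tests, and it is blocked when no parameters fit. *)
Definition lstep (i : nat) (c c' : nat -> nat) :=
  exists d, forall r, r < R -> c r = ev (src i r) d /\ c' r = ev (dst i r) d.

Fixpoint lpath (T : nat) (c c' : nat -> nat) : Prop :=
  if T is T'.+1 then
    exists i, i < K /\ exists2 c1, lstep i c c1 & lpath T' c1 c'
  else forall r, r < R -> c r = c' r.

Fixpoint lpath_le (e T : nat) (c c' : nat -> nat) : Prop :=
  if T is T'.+1 then
    exists i d c1, [/\ i < K,
      forall r, r < R -> [/\ d r < 2 ^ e, c r = ev (src i r) d & c1 r = ev (dst i r) d]
      & lpath_le e T' c1 c']
  else forall r, r < R -> c r = c' r.

Hypothesis forms_lt :
  forall i r, i < K -> r < R -> (src i r).1.2 < R /\ (dst i r).1.2 < R.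

(* Digits built from rule coefficients and parameters below [2 ^ e] stay below the base
   [2 ^ (e + width)], so that no carries occur. *)
Definition width := (K + \sum_(i < K) \sum_(r < R)
  (((src i r).1.1 + (src i r).2) + ((dst i r).1.1 + (dst i r).2))).+1.

Definition lin (phi : nat -> nat -> form) (S : nat -> nat) (V : nat -> nat -> nat) r :=
  \sum_(i < K) ((phi i r).1.1 * V i (phi i r).1.2 + (phi i r).2 * S i).

(* In base [X], the digit of index [t] of [S i] is 1 if rule [i] is applied at time [t]
   and 0 otherwise, and that of [V i j] is the value of the [j]-th parameter of rule [i]
   at that time, or 0 if the rule is not applied. The last equation says that each
   transition starts in the state in which the previous one ended. *)
Definition traces X e T (c c' : nat -> nat) (S : nat -> nat) (V : nat -> nat -> nat) :=
  [/\ \sum_(i < K) S i = repunit X T,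
      forall i, i < K -> bitsub (S i) (repunit X T),
      forall i j, i < K -> j < R -> bitsub (V i j) ((2 ^ e - 1) * S i),
      forall r, r < R -> c r < X
    & forall r, r < R -> X * lin dst S V r + c r = lin src S V r + X ^ T * c' r].

Lemma lin_block phi X (S0 S1 : nat -> nat) V0 V1 r :
  lin phi (fun i => S0 i + X * S1 i) (fun i j => V0 i j + X * V1 i j) r =
  lin phi S0 V0 r + X * lin phi S1 V1 r.
Proof.
rewrite /lin big_distrr -big_split /=; apply: eq_bigr => i _; lia.
Qed.

Lemma eq_lin phi S S' V V' r :
  (forall i, i < K -> (phi i r).1.2 < R) ->
  (forall i, i < K -> S i = S' i) -> (forall i j, i < K -> j < R -> V i j = V' i j) ->
  lin phi S V r = lin phi S' V' r.
Proof. by move=> h eS eV; apply: eq_bigr => i _; rewrite eS // eV // h. Qed.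

Lemma lin_unit phi i0 d r : i0 < K ->
  lin phi (fun i => i == i0) (fun i j => (i == i0) * d j) r = ev (phi i0 r) d.
Proof.
move=> lti; rewrite /lin (bigD1 (Ordinal lti)) //= eqxx mul1n muln1 big1 ?addn0 //.
move=> i; rewrite -val_eqE /= => /negbTE ->.
by rewrite mul0n !muln0.
Qed.

Section Width.

Variables (e : nat).
Let X := 2 ^ (e + width).

Lemma base_gt1 : 1 < X.
Proof. by rewrite /X /width addnS -(expn0 2) ltn_exp2l. Qed.

Lemma form_lt_base i r d : i < K -> r < R -> (forall j, j < R -> d j < 2 ^ e) ->
  ev (src i r) d < X /\ ev (dst i r) d < X.
Proof.
move=> iK rR dlt; have [s1 s2] := forms_lt iK rR.
have hw : ((src i r).1.1 + (src i r).2) + ((dst i r).1.1 + (dst i r).2) < width.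
  rewrite /width ltnS (bigD1 (Ordinal iK)) //= (bigD1 (Ordinal rR)) //=; lia.
have hX : X = 2 ^ e * 2 ^ width by rewrite /X expnD.
have hw2 : width < 2 ^ width by apply: ltn_expl.
have e0 : 0 < 2 ^ e by rewrite expn_gt0.
rewrite hX /ev; have := dlt _ s1; have := dlt _ s2.
move: (2 ^ e) (2 ^ width) (d _) (d _) hw2 e0 => E W x y; split; nia.
Qed.

(** Induction on [T], peeling off the lowest digit in base [X]: that digit describes the first
    transition, and the quotients form a trace of the rest. *)
Lemma traces_path T c c' :
  (forall r, r < R -> c r < X) -> 
  (exists S V, traces X e T c c' S V) <-> lpath_le e T c c'.
Proof.
have X1 := base_gt1; have X0 : 0 < X by lia.
have KX : K < X.
  by apply: (@ltn_trans (e + width)); [rewrite /width; lia | apply: ltn_expl].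
have eX : 2 ^ e <= X by rewrite leq_exp2l // leq_addr.
have e0 : 0 < 2 ^ e by rewrite expn_gt0.
elim: T c => [|T IHT] c cX.
  split=> [[S [V [_ hS hV _ hc]]] r rR|hc] /=.
    have S0 i : i < K -> S i = 0.
      by move=> /hS; rewrite /repunit big_ord0 bitsub0r => /eqP.
    have V0 i j : i < K -> j < R -> V i j = 0.
      by move=> iK jR; have := hV i j iK jR; rewrite S0 // muln0 bitsub0r => /eqP.
    have z phi : (forall i, i < K -> (phi i r).1.2 < R) -> lin phi S V r = 0.
      move=> h; rewrite (eq_lin (S' := fun=> 0) (V' := fun _ _ => 0) h) //.
      by rewrite /lin big1 // => i _; rewrite !muln0.
    have := hc r rR; rewrite !z ?muln0 ?add0n ?expn0 ?mul1n //.
      by move=> i iK; have [] := forms_lt iK rR.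
    by move=> i iK; have [] := forms_lt iK rR.
  exists (fun=> 0), (fun _ _ => 0); split=> //.
  - by rewrite big1 // /repunit big_ord0.
  - by move=> i _; rewrite /repunit big_ord0.
  - by move=> i j _ _; rewrite muln0.
  - move=> r rR; rewrite hc // expn0 mul1n; congr (_ + _).
    by rewrite /lin !big1 ?muln0 // => i _; rewrite !muln0.
split.
  move=> [S [V [sumS hS hV _ hc]]].
  pose s i := S i %% X; pose S' i := S i %/ X.
  pose v i j := V i j %% X; pose V' i j := V i j %/ X.
  have sX i : s i < X by rewrite ltn_mod.
  have vX i j : v i j < X by rewrite ltn_mod.
  have ES i : S i = s i + X * S' i by rewrite addnC mulnC -divn_eq.
  have EV i j : V i j = v i j + X * V' i j by rewrite addnC mulnC -divn_eq.
  have mS i : i < K -> (s i <= 1) && bitsub (S' i) (repunit X T).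
    move=> iK; have := hS i iK; rewrite repunitS ES bitsub_block ?sX //.
    move=> /andP[h ->]; rewrite andbT leqNgt; apply: contraL h => lt.
    by rewrite /bitsub bin_small.
  have sums : \sum_(i < K) s i = 1 /\ \sum_(i < K) S' i = repunit X T.
    move: sumS; rewrite repunitS (eq_bigr (fun i : 'I_K => s i + X * S' i)); last by [].
    rewrite big_split -big_distrr /= => E.
    (* At most [K] digits 1 are added and [K < X], so nothing carries: the lowest digits of the
       [S i] sum to 1, and exactly one rule [i0] is applied first. *)
    have le : \sum_(i < K) s i <= K.
      rewrite -[X in _ <= X]card_ord -sum1_card; apply: leq_sum => i _.
      by case/andP: (mS _ (ltn_ord i)).
    by apply: low_digit E => //; exact: leq_ltn_trans le KX.
  case: sums => sum1 sumS'.
  have [i0 si0] : exists i : 'I_K, s i = 1.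
    case: (pickP (fun i : 'I_K => s i == 1)) => [i /eqP si|h]; first by exists i.
    move: sum1; rewrite big1 // => i _; have := h i.
    by case/andP: (mS _ (ltn_ord i)); case: (s i) => [|[]].
  have sE i : i < K -> s i = (i == i0).
    move=> iK; case: eqP => [->//|ne]; move: sum1; rewrite (bigD1 i0) //= si0.
    rewrite (bigD1 (Ordinal iK)) /=; first by lia.
    by rewrite -val_eqE /=; apply/eqP.
  pose d := v i0.
  (* The mask [(2 ^ e - 1) * s i] is 0 or a block of [e] ones, so inclusion cancels the parameters
     of the other rules and bounds those of [i0]. *)
  have mV i j : i < K -> j < R ->
      bitsub (v i j) ((2 ^ e - 1) * s i) && bitsub (V' i j) ((2 ^ e - 1) * S' i).
    move=> iK jR; have := hV i j iK jR; rewrite EV ES mulnDr mulnCA bitsub_block //.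
    by case/andP: (mS i iK) => h _; case: (s i) h => [|[|]] // _; lia.
  have vE i j : i < K -> j < R -> v i j = (i == i0) * d j.
    move=> iK jR; case: eqP => [->|ne]; first by rewrite mul1n.
    have /andP[+ _] := mV i j iK jR.
    by rewrite sE //; case: eqP => // _; rewrite muln0 bitsub0r => /eqP.
  have dlt j : j < R -> d j < 2 ^ e.
    move=> jR; have /andP[+ _] := mV i0 j (ltn_ord i0) jR.
    by rewrite si0 muln1 bitsub_pred_exp2.
  have linE phi r : (forall i, i < K -> (phi i r).1.2 < R) ->
      lin phi S V r = ev (phi i0 r) d + X * lin phi S' V' r.
    move=> h; rewrite -(lin_unit phi d r (ltn_ord i0)) -lin_block; apply: eq_lin => //.
      by move=> i iK; rewrite ES sE.
    by move=> i j iK jR; rewrite EV vE.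
  pose c1 r := ev (dst i0 r) d.
  (* The lowest digit of the linear equation identifies [c] with the source of [i0]; division by [X]
     leaves the equation of a trace starting at [c1]. *)
  have digits r : r < R -> c r = ev (src i0 r) d /\
      X * lin dst S' V' r + c1 r = lin src S' V' r + X ^ T * c' r.
    move=> rR; have := hc r rR.
    rewrite !linE; try by move=> i iK; have [] := forms_lt iK rR.
    have [l1 _] := form_lt_base (ltn_ord i0) rR dlt.
    rewrite -addnA expnS -mulnA -mulnDr => E.
    have [-> E'] := low_digit (cX r rR) l1 (etrans (addnC _ _) E).
    by split=> //; rewrite addnC.
  exists i0, d, c1; split=> //.
    by move=> r rR; split=> //; [exact: dlt | case: (digits r rR)].
  apply/IHT.
    by move=> r rR; have [] := form_lt_base (ltn_ord i0) rR dlt.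
  exists S', V'; split=> //.
  - by move=> i /mS/andP[].
  - by move=> i j iK jR; case/andP: (mV i j iK jR).
  - by move=> r rR; have [] := form_lt_base (ltn_ord i0) rR dlt.
  - by move=> r /digits[].
move=> [i0 [d [c1 [iK hd]]]].
have dlt j : j < R -> d j < 2 ^ e by case/hd.
have c1X r : r < R -> c1 r < X.
  by move=> rR; have [_ _ ->] := hd r rR; have [] := form_lt_base iK rR dlt.
move=> /(IHT _ c1X)[S' [V' [sumS hS hV _ hc]]].
exists (fun i => (i == i0) + X * S' i), (fun i j => (i == i0) * d j + X * V' i j).
split=> //.
- rewrite big_split -big_distrr /= sumS repunitS; congr (_ + _).
  rewrite (bigD1 (Ordinal iK)) //= eqxx big1 // => i.
  by rewrite -val_eqE /= => /negbTE ->.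
- move=> i lti; rewrite repunitS bitsub_block ?hS ?andbT //; last by case: eqP.
  by case: eqP.
- move=> i j lti jR; rewrite mulnDr mulnCA bitsub_block ?hV ?andbT //.
  + case: eqP => _; last by rewrite mul0n muln0 bitsub0r.
    by rewrite mul1n muln1 bitsub_pred_exp2 dlt.
  + by case: eqP => _; rewrite ?mul0n ?mul1n //; apply: leq_trans eX; apply: dlt.
  + by case: eqP => _; rewrite ?muln0 ?muln1; lia.
- move=> r rR; rewrite !lin_block !lin_unit //.
  have [_ -> <-] := hd r rR.
  by rewrite expnS -mulnA -[RHS]addnA -mulnDr -hc // addnC [c1 r + _]addnC.
Qed.

End Width.

Lemma lpath_le_mono e e' T c c' : e <= e' -> lpath_le e T c c' -> lpath_le e' T c c'.
Proof.
move=> le; elim: T c => [|T IHT] c //= [i [d [c1 [iK hd /IHT p]]]].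
exists i, d, c1; split=> // r /hd[dlt -> ->]; split=> //.
by apply: leq_trans dlt _; rewrite leq_exp2l.
Qed.

(** A run involves finitely many parameters, and [x < 2 ^ x] turns their maximum into a suitable
    [e]. *)
Lemma lpathP T c c' : lpath T c c' <-> exists e, lpath_le e T c c'.
Proof.
elim: T c => [|T IHT] c /=; first by split=> [h|[e]//]; exists 0.
split.
  move=> [i [iK [c1 [d hd] /IHT[e p]]]].
  pose e' := \max_(r < R) d r; exists (e + e'), i, d, c1; split=> //.
    move=> r rR; have [h1 h2] := hd r rR; split=> //.
    apply: (@leq_trans (e + e').+1); last exact: ltn_expl.
    rewrite ltnS; apply: (@leq_trans e'); last exact: leq_addl.
    exact: (leq_bigmax (Ordinal rR)).
  by apply: lpath_le_mono p; exact: leq_addr.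
move=> [e [i [d [c1 [iK hd p]]]]]; exists i; split=> //; exists c1.
  by exists d => r /hd[].
by apply/IHT; exists e.
Qed.

Lemma reach_traces c c' :
  (exists T, lpath T c c') <->
  exists T e S V, traces (2 ^ (e + width)) e T c c' S V.
Proof.
split.
  move=> [T /lpathP[e p]].
  (* [e] is enlarged by the maximum of the initial state, to meet the clause [c r < X] of
     [traces]. *)
  pose e' := \max_(r < R) c r.
  have cX r : r < R -> c r < 2 ^ (e + e' + width).
    move=> rR; apply: (@leq_trans (e + e' + width).+1); last exact: ltn_expl.
    rewrite ltnS; apply: (@leq_trans e'); first exact: (leq_bigmax (Ordinal rR)).
    by rewrite -addnA addnCA leq_addr.
  have /(traces_path _ _ cX) [S [V h]] := lpath_le_mono (leq_addr e' e) p.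
  by exists T, (e + e'), S, V.
move=> [T [e [S [V h]]]]; exists T; apply/lpathP; exists e.
apply/traces_path; first by case: h.
by exists S, V.
Qed.

End Linear.

(** * Register programs for recursive functions *)

Inductive star (T : Type) (R : T -> T -> Prop) : T -> T -> Prop :=
| star_refl x : star R x x
| star_step x y z : R x y -> star R y z -> star R x z.

Lemma star_trans T (R : T -> T -> Prop) x y z : star R x y -> star R y z -> star R x z.
Proof. by elim=> // {}x y' {}y h _ IH /IH; apply: star_step h. Qed.

Lemma star_rcons T (R : T -> T -> Prop) x y z : star R x y -> R y z -> star R x z.
Proof. by move=> h hz; apply: star_trans h _; apply: star_step hz _; exact: star_refl. Qed.

(* The atom [(r, p, q)] turns any state of the form [d(r := p d)] into [d(r := q d)];
   a constraint on [p] thus acts as a test. *)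
Definition atom : Type := (nat * form * form)%type.

Inductive cmd := Atom of atom | Seq of cmd & cmd | Star of cmd.

Definition arel (a : atom) (c c' : nat -> nat) :=
  exists d, [/\ forall x, x != a.1.1 -> c x = d x /\ c' x = d x,
                c a.1.1 = ev a.1.2 d & c' a.1.1 = ev a.2 d].

Fixpoint run (p : cmd) : (nat -> nat) -> (nat -> nat) -> Prop :=
  match p with
  | Atom a => arel a
  | Seq p1 p2 => fun c c' => exists2 c1, run p1 c c1 & run p2 c1 c'
  | Star p => star (run p)
  end.

(** The middle form is matched against the old value: [(1, r, 0)] accepts anything, [(1, r, 1)] only
    positive values, [(0, 0, 0)] only 0, and [(1, r', 0)] only the content of [r']. *)
Definition set r q := Atom (r, (1, r, 0), q).
Definition decr r := Atom (r, (1, r, 1), (1, r, 0)).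
Definition test0 r := Atom (r, (0, 0, 0), (0, 0, 0)).
Definition test_eq r r' := Atom (r, (1, r', 0), (1, r', 0)).

Definition upd (c : nat -> nat) r v x := if x == r then v else c x.

Lemma upd_eq c r v : upd c r v r = v.
Proof. by rewrite /upd eqxx. Qed.

Lemma upd_lt c r v b x : b <= r -> x < b -> upd c r v x = c x.
Proof. by rewrite /upd => br xb; case: eqP => // xr; lia. Qed.

Lemma upd_neq c r v x : x != r -> upd c r v x = c x.
Proof. by rewrite /upd => /negbTE ->. Qed.

Lemma run_set r q c c' : run (set r q) c c' -> c' =1 upd c r (ev q c).
Proof.
case=> d /= [h]; rewrite /ev /= mul1n addn0 => h1 h2 x.
have cd y : d y = c y by have [->//|/h[]] := eqVneq y r.
by rewrite /upd; case: eqVneq => [->|/h[-> ->]]; rewrite ?h2 ?cd.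
Qed.

Lemma set_run r q c : run (set r q) c (upd c r (ev q c)).
Proof.
exists c; rewrite /= upd_eq; split=> //; last by rewrite /ev /= mul1n addn0.
by move=> x h; rewrite upd_neq.
Qed.

Lemma run_decr r c c' : run (decr r) c c' -> c r = (c' r).+1 /\ c' =1 upd c r (c' r).
Proof.
case=> d /= [h]; rewrite /ev /= mul1n addn0 addn1 => h1 h2; split; first by rewrite h2.
by move=> x; rewrite /upd; case: eqVneq => [->//|/h[-> ->]].
Qed.

Lemma decr_run r c v : c r = v.+1 -> run (decr r) c (upd c r v).
Proof.
move=> h; exists (upd c r v); rewrite /= /ev /= upd_eq mul1n addn0 addn1 h; split=> //.
by move=> x hx; rewrite upd_neq.
Qed.

Lemma run_test0 r c c' : run (test0 r) c c' -> c r = 0 /\ c' =1 c.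
Proof.
case=> d /= [h]; rewrite /ev /= mul0n => h1 h2; split=> //.
by move=> x; have [->|/h[-> ->]//] := eqVneq x r; rewrite h1 h2.
Qed.

Lemma test0_run r c : c r = 0 -> run (test0 r) c c.
Proof. by move=> h; exists c; rewrite /= /ev /= mul0n h. Qed.

Lemma run_test_eq r r' c c' : r' != r -> run (test_eq r r') c c' -> c r = c r' /\ c' =1 c.
Proof.
move=> ne; case=> d /= [h]; rewrite /ev /= mul1n addn0 => h1 h2.
split; first by have [-> _] := h _ ne.
by move=> x; have [->|/h[-> ->]//] := eqVneq x r; rewrite h1 h2.
Qed.

Lemma test_eq_run r r' c : c r = c r' -> run (test_eq r r') c c.
Proof. by move=> h; exists c; rewrite /= /ev /= mul1n addn0 h. Qed.

(* [compile f a o b] computes [f] on the registers [a] into the register [o], using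
   only registers from [b] on as scratch space. *)
Fixpoint compile n (f : recfun n) : n.-tuple nat -> nat -> nat -> cmd :=
  match f in recfun n return n.-tuple nat -> nat -> nat -> cmd with
  | RZero _ => fun _ o _ => set o (0, 0, 0)
  | RSucc => fun a o _ => set o (1, thead a, 1)
  | RProj _ i => fun a o _ => set o (1, tnth a i, 0)
  | RComp m _ f g => fun a o b =>
      foldr (fun i => Seq (compile (g i) a (b + i) (b + m)))
        (compile f [tuple b + i | i < m] o (b + m)) (enum 'I_m)
  | RPrim _ f g => fun a o b =>
      Seq (compile f (behead_tuple a) b.+1 b.+3)
     (Seq (set b (0, 0, 0))
     (Seq (Star (Seq (compile g (cons_tuple b (cons_tuple b.+1 (behead_tuple a))) b.+2 b.+3)
                (Seq (set b.+1 (1, b.+2, 0)) (set b (1, b, 1)))))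
     (Seq (test_eq b (thead a)) (set o (1, b.+1, 0)))))
  | RMin _ f => fun a o b =>
      Seq (set b (0, 0, 0))
     (Seq (Star (Seq (compile f (cons_tuple b a) b.+1 b.+2)
                (Seq (decr b.+1) (set b (1, b, 1)))))
     (Seq (compile f (cons_tuple b a) b.+1 b.+2)
     (Seq (test0 b.+1) (set o (1, b, 0)))))
  end.

Lemma eq_map_tuple n (a : n.-tuple nat) (c c' : nat -> nat) :
  {in a, c =1 c'} -> map_tuple c a = map_tuple c' a.
Proof. by move=> h; apply: val_inj => /=; apply/eq_in_map. Qed.

Lemma behead_map_tuple n (a : n.+1.-tuple nat) (c : nat -> nat) :
  behead_tuple (map_tuple c a) = map_tuple c (behead_tuple a).
Proof. by apply: val_inj; rewrite /= behead_map. Qed.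

Lemma cons_map_tuple n (a : n.-tuple nat) (c : nat -> nat) x :
  cons_tuple (c x) (map_tuple c a) = map_tuple c (cons_tuple x a).
Proof. exact: val_inj. Qed.

Lemma thead_map_tuple n (a : n.+1.-tuple nat) (c : nat -> nat) :
  thead (map_tuple c a) = c (thead a).
Proof. by rewrite /thead tnth_map. Qed.

Lemma lt_cons b n (a : n.-tuple nat) x :
  x < b -> {in a, forall y, y < b} -> {in cons_tuple x a, forall y, y < b}.
Proof. by move=> xb ab y; rewrite inE => /predU1P[->//|/ab]. Qed.

Lemma ltW_in b b' n (a : n.-tuple nat) :
  b <= b' -> {in a, forall x, x < b} -> {in a, forall x, x < b'}.
Proof. by move=> le ab x /ab lt; apply: leq_trans le. Qed.

(** Loops make an arbitrary number of rounds and a wrong choice merely blocks, so only successful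
    runs are considered. The first clause, by which other registers below [b] survive, makes calls
    composable. *)
Definition sound n (f : recfun n) := forall (a : n.-tuple nat) o b c c',
  {in a, forall x, x < b} -> o < b -> run (compile f a o b) c c' ->
  (forall x, x < b -> x != o -> c' x = c x) /\ reval f (map_tuple c a) (c' o).

Lemma compile_sound n (f : recfun n) : sound f.
Proof.
elim: f => {n}.
- move=> n a o b c c' _ ob /run_set h; split; last by rewrite /= h upd_eq.
  by move=> x _ xo; rewrite h upd_neq.
- move=> a o b c c' _ ob /run_set h; split.
    by move=> x _ xo; rewrite h upd_neq.
  by rewrite /= h upd_eq thead_map_tuple /ev /= mul1n addn1.
- move=> n i a o b c c' _ ob /run_set h; split.
    by move=> x _ xo; rewrite h upd_neq.
  by rewrite /= h upd_eq tnth_map /ev /= mul1n addn0.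
- move=> m n f IHf g IHg a o b c c' ab ob /= h.
  have bm : b <= b + m by exact: leq_addr.
  (* The induction runs over the indices still to be processed; results already stored are untouched
     by the later calls, which write elsewhere. *)
  have loop (s : seq 'I_m) c0 : uniq s -> (forall x, x < b -> c0 x = c x) ->
      run (foldr (fun i => Seq (compile (g i) a (b + i) (b + m)))
        (compile f [tuple b + i | i < m] o (b + m)) s) c0 c' ->
      exists c1, [/\ forall x, x < b -> c1 x = c x,
        forall i, i \in s -> reval (g i) (map_tuple c a) (c1 (b + i)),
        forall i : 'I_m, i \notin s -> c1 (b + i) = c0 (b + i)
        & run (compile f [tuple b + i | i < m] o (b + m)) c1 c'].
    elim: s c0 => [|i s IHs] c0 /=; first by move=> _ hc hr; exists c0.
    case/andP=> is_ us hc [c1 h1 h2].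
    have [|fr ev1] := IHg i _ _ _ _ _ (ltW_in bm ab) (_ : b + i < b + m) h1.
      by rewrite ltn_add2l.
    have hc1 x : x < b -> c1 x = c x.
      by move=> xb; rewrite fr ?hc //; [exact: leq_trans bm | lia].
    have [|c2 [hc2 r2 n2 run2]] := IHs c1 us hc1; first exact: h2.
    exists c2; split=> //.
      move=> j; rewrite inE => /predU1P[->|/r2//]; rewrite n2 //.
      by rewrite -(@eq_map_tuple _ a c0 c) // => x /ab /hc.
    move=> j; rewrite inE negb_or => /andP[ji /n2 ->]; rewrite fr ?ltn_add2l //.
    by rewrite eqn_add2l.
  have [|c1 [hc1 r1 _ h1]] := loop _ c (enum_uniq _) _ h; first by [].
  have [||fr r] := IHf _ _ _ _ _ _ _ h1.
  + by move=> x /mapP[i _ ->]; rewrite ltn_add2l.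
  + exact: leq_trans bm.
  split; first by move=> x xb xo; rewrite fr ?hc1 //; exact: leq_trans bm.
  exists (map_tuple c1 [tuple b + i | i < m]) => // i.
  by rewrite tnth_map tnth_mktuple; apply: r1; rewrite mem_enum.
- move=> n f IHf g IHg a o b c c' ab ob /=.
  move=> [c1 hf [c2 /run_set h2 [c3 hloop [c4 ht /run_set h4]]]].
  have atl : {in behead_tuple a, forall x, x < b} by move=> x /mem_behead /ab.
  have b3 : b <= b.+3 by lia.
  have [//|fr1 r1] := IHf _ _ _ _ _ (ltW_in b3 atl) (_ : b.+1 < b.+3) hf.
  have tb : thead a < b by apply: ab; exact: mem_tnth.
  have [|eq4 e4] := run_test_eq _ ht.
    by rewrite neq_ltn tb.
  rewrite thead_map_tuple behead_map_tuple.
  pose base := reval f (map_tuple c (behead_tuple a)).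
  pose stp k r := reval g (cons_tuple k (cons_tuple r (map_tuple c (behead_tuple a)))).
  (* Loop invariant: [b] holds the counter [k], and [b.+1] the value of the recursion at [k]. *)
  have inv2 : (forall x, x < b -> c2 x = c x) /\ primrec_graph base stp (c2 b) (c2 b.+1).
    split; first by move=> x xb; rewrite h2 (upd_lt _ _ _ xb) // fr1 //; lia.
    rewrite !h2 upd_eq upd_neq; last by lia.
    exact: r1.
  have {inv2} [fr3 r3] : (forall x, x < b -> c3 x = c x) /\ primrec_graph base stp (c3 b) (c3 b.+1).
    elim: hloop inv2 => // {h2 ht eq4 e4} {}c2 d {}c3
      [d1 hg [d2 /run_set e1 /run_set e2]] _ IH [fr2 r2].
    apply: IH.
    have [||frg rg] := IHg _ _ _ _ _ _ _ hg; [|by []|].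
      by do 2 (apply: lt_cons; first by lia); apply: ltW_in atl; lia.
    split.
      by move=> x xb; rewrite e2 (upd_lt _ _ _ xb) // e1 (upd_lt _ _ _ xb) ?frg ?fr2 //; lia.
    have -> : d b = (c2 b).+1.
      by rewrite e2 upd_eq /ev /= mul1n addn1 e1 upd_neq ?frg //; lia.
    have -> : d b.+1 = d1 b.+2.
      by rewrite e2 upd_neq ?e1 ?upd_eq; [rewrite /ev /= mul1n addn0 | lia].
    exists (c2 b.+1) => //; rewrite /stp.
    rewrite -(@eq_map_tuple _ (behead_tuple a) c2 c); first by rewrite !cons_map_tuple.
    by move=> x /atl /fr2.
  split; first by move=> x xb xo; rewrite h4 upd_neq // e4 fr3.
  rewrite h4 upd_eq /ev /= mul1n addn0 e4.
  by rewrite -(fr3 _ tb) -eq4.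
- move=> n f IHf a o b c c' ab ob /=.
  move=> [c1 /run_set h1 [c2 hloop [c3 hf [c4 /run_test0[c30 e4] /run_set h4]]]].
  have b2 : b <= b.+2 by lia.
  have acons : {in cons_tuple b a, forall x, x < b.+2}.
    by apply: lt_cons; [lia | apply: ltW_in ab].
  (* Loop invariant: [f] has been found positive at every argument below the content of [b]. *)
  have inv1 : (forall x, x < b -> c1 x = c x) /\
     forall z, z < c1 b -> exists r, reval f (cons_tuple z (map_tuple c a)) r.+1.
    split; first by move=> x xb; rewrite h1 (upd_lt _ _ _ xb).
    by rewrite h1 upd_eq.
  have {inv1} [fr2 r2] : (forall x, x < b -> c2 x = c x) /\
     forall z, z < c2 b -> exists r, reval f (cons_tuple z (map_tuple c a)) r.+1.
    elim: hloop inv1 => // {h1 hf c30 e4} {}c1 d {}c2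
      [d1 hf [d2 /run_decr[e0 e1] /run_set e2]] _ IH [fr1 r1].
    apply: IH.
    have [//|frf rf] := IHf _ _ _ _ _ acons _ hf.
    split.
      by move=> x xb; rewrite e2 (upd_lt _ _ _ xb) // e1 (upd_lt _ _ _ xb) ?frf ?fr1 //; lia.
    have -> : d b = (c1 b).+1.
      by rewrite e2 upd_eq /ev /= mul1n addn1 e1 upd_neq ?frf //; lia.
    move=> z; rewrite ltnS leq_eqVlt => /predU1P[->|/r1//].
    exists (d2 b.+1); rewrite -e0.
    rewrite -(@eq_map_tuple _ a c1 c); first by rewrite cons_map_tuple.
    by move=> x /ab /fr1.
  have [//|frf rf] := IHf _ _ _ _ _ acons (_ : b.+1 < b.+2) hf.
  have cb : c' o = c2 b.
    by rewrite h4 upd_eq /ev /= mul1n addn0 e4 frf //; lia.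
  split; first by move=> x xb xo; rewrite h4 upd_neq // e4 frf ?fr2 //; lia.
  rewrite cb; split=> //; rewrite -c30.
  rewrite -(@eq_map_tuple _ a c2 c); first by rewrite cons_map_tuple.
  by move=> x /ab /fr2.
Qed.

(** The run is built by always guessing right. As the induction hypotheses give only the result of a
    call, [compile_sound] is applied to the same run to see that the other registers are
    preserved. *)
Lemma compile_complete n (f : recfun n) (a : n.-tuple nat) o b c y :
  {in a, forall x, x < b} -> o < b -> reval f (map_tuple c a) y ->
  exists2 c', run (compile f a o b) c c' & c' o = y.
Proof.
elim: f a o b c y => {n}.
- move=> n a o b c y _ _ /= ->.
  by exists (upd c o (ev (0, 0, 0) c)); [exact: set_run | rewrite upd_eq].
- move=> a o b c y _ _ /= ->; eexists; first exact: set_run.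
  by rewrite upd_eq thead_map_tuple /ev /= mul1n addn1.
- move=> n i a o b c y _ _ /= ->; eexists; first exact: set_run.
  by rewrite upd_eq tnth_map /ev /= mul1n addn0.
- move=> m n f IHf g IHg a o b c y ab ob /= [w hw hf].
  have bm : b <= b + m by exact: leq_addr.
  have loop (s : seq 'I_m) c0 : (forall x, x < b -> c0 x = c x) ->
      (forall i, i \notin s -> c0 (b + i) = tnth w i) ->
      exists2 c', run (foldr (fun i => Seq (compile (g i) a (b + i) (b + m)))
        (compile f [tuple b + i | i < m] o (b + m)) s) c0 c' & c' o = y.
    elim: s c0 => [|i s IHs] c0 hc h0 /=.
      apply: IHf; last first.
      + have -> // : map_tuple c0 [tuple b + i | i < m] = w.
        by apply: eq_from_tnth => i; rewrite tnth_map tnth_mktuple h0.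
      + exact: leq_trans bm.
      by move=> x /mapP[i _ ->]; rewrite ltn_add2l.
    have r1 : reval (g i) (map_tuple c0 a) (tnth w i).
      by rewrite (@eq_map_tuple _ a c0 c) // => x /ab /hc.
    have bi : b + i < b + m by rewrite ltn_add2l.
    have [c1 h1 e1] := IHg i _ _ _ _ _ (ltW_in bm ab) bi r1.
    have [fr _] := compile_sound (ltW_in bm ab) bi h1.
    have [||c' h' <-] := IHs c1; last by exists c' => //; exists c1.
      by move=> x xb; rewrite fr ?hc //; [exact: leq_trans bm | lia].
    move=> j js; have [->//|ji] := eqVneq j i.
    rewrite fr ?ltn_add2l ?eqn_add2l //; apply: h0.
    by rewrite inE negb_or ji.
  by apply: loop => // i; rewrite mem_enum.
- move=> n f IHf g IHg a o b c y ab ob /=.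
  have atl : {in behead_tuple a, forall x, x < b} by move=> x /mem_behead /ab.
  have b3 : b <= b.+3 by lia.
  have tb : thead a < b by apply: ab; exact: mem_tnth.
  rewrite thead_map_tuple behead_map_tuple; move=> pr.
  pose body := Seq (compile g (cons_tuple b (cons_tuple b.+1 (behead_tuple a))) b.+2 b.+3)
    (Seq (set b.+1 (1, b.+2, 0)) (set b (1, b, 1))).
  have loop k z : primrec_graph (reval f (map_tuple c (behead_tuple a)))
      (fun k r => reval g (cons_tuple k (cons_tuple r (map_tuple c (behead_tuple a))))) k z ->
      exists c3, [/\ run (Seq (compile f (behead_tuple a) b.+1 b.+3)
        (Seq (set b (0, 0, 0)) (Star body))) c c3, c3 b = k, c3 b.+1 = z &
        forall x, x < b -> c3 x = c x].
    elim: k z => [|k IHk] z /=.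
      case/(IHf _ b.+1 b.+3 _ _ (ltW_in b3 atl)) => // c1 h1 e1.
      have [//|fr _] := compile_sound (ltW_in b3 atl) _ h1.
      exists (upd c1 b 0); split; rewrite ?upd_eq //.
      - exists c1 => //; exists (upd c1 b 0); first exact: set_run.
        exact: star_refl.
      - by rewrite upd_neq //; lia.
      - by move=> x xb; rewrite (upd_lt _ _ _ xb) // fr //; lia.
    case=> r /IHk[c3 [[c1 h1 [c2 h2 h3]] ck cr fr3]] hg {IHk}.
    have a3 : {in cons_tuple b (cons_tuple b.+1 (behead_tuple a)), forall x, x < b.+3}.
      by do 2 (apply: lt_cons; first by lia); apply: ltW_in atl; lia.
    rewrite -(@eq_map_tuple _ (behead_tuple a) c3 c) in hg; last by move=> x /atl /fr3.
    rewrite -ck -cr !cons_map_tuple in hg.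
    have [//|c4 h4 e4] := IHg _ b.+2 _ _ _ a3 _ hg.
    have [//|fr4 _] := compile_sound a3 _ h4.
    exists (upd (upd c4 b.+1 (c4 b.+2)) b (c4 b).+1); split.
    - exists c1 => //; exists c2 => //; apply: star_rcons h3 _.
      exists c4 => //; exists (upd c4 b.+1 (c4 b.+2)).
        have := set_run b.+1 (1, b.+2, 0) c4.
        by rewrite /ev /= mul1n addn0.
      have := set_run b (1, b, 1) (upd c4 b.+1 (c4 b.+2)).
      by rewrite /ev /= mul1n addn1 upd_neq //; lia.
    - by rewrite upd_eq fr4 ?ck //; lia.
    - by rewrite upd_neq ?upd_eq ?e4 //; lia.
    - by move=> x xb; rewrite !(upd_lt _ _ _ xb) // ?fr4 ?fr3 //; lia.
  have [c3 [[c1 h1 [c2 h2 h3]] ck cy fr3]] := loop _ _ pr.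
  exists (upd c3 o (ev (1, b.+1, 0) c3)); last by rewrite upd_eq /ev /= mul1n addn0.
  exists c1 => //; exists c2 => //; exists c3 => //; exists c3; last exact: set_run.
  by apply: test_eq_run; rewrite ck fr3.
- move=> n f IHf a o b c y ab ob /= [fy fz].
  have acons : {in cons_tuple b a, forall x, x < b.+2}.
    by apply: lt_cons; [lia | apply: ltW_in ab; lia].
  pose body := Seq (compile f (cons_tuple b a) b.+1 b.+2) (Seq (decr b.+1) (set b (1, b, 1))).
  have call c1 r : (forall x, x < b -> c1 x = c x) ->
      reval f (cons_tuple (c1 b) (map_tuple c a)) r ->
      exists c2, [/\ run (compile f (cons_tuple b a) b.+1 b.+2) c1 c2, c2 b.+1 = r,
        c2 b = c1 b & forall x, x < b -> c2 x = c x].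
    move=> fr1; rewrite -(@eq_map_tuple _ a c1 c); last by move=> x /ab /fr1.
    rewrite cons_map_tuple => hf.
    have [//|c2 h2 e2] := IHf _ b.+1 _ _ _ acons _ hf.
    have [//|fr2 _] := compile_sound acons _ h2.
    exists c2; split=> //; first by rewrite fr2 //; lia.
    by move=> x xb; rewrite fr2 ?fr1 //; lia.
  have loop k : k <= y -> exists c2, [/\ run (Seq (set b (0, 0, 0)) (Star body)) c c2,
      c2 b = k & forall x, x < b -> c2 x = c x].
    elim: k => [|k IHk] ky.
      exists (upd c b 0); split; rewrite ?upd_eq //.
        by exists (upd c b 0); [exact: set_run | exact: star_refl].
      by move=> x xb; rewrite (upd_lt _ _ _ xb).
    have [c2 [[c1 h1 h2] ck fr2]] := IHk (ltnW ky).
    have [r fr] := fz _ ky; rewrite -ck in fr.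
    have [c3 [h3 e3 b3 fr3]] := call _ _ fr2 fr.
    exists (upd (upd c3 b.+1 r) b (c3 b).+1); split.
    - exists c1 => //; apply: star_rcons h2 _; exists c3 => //.
      exists (upd c3 b.+1 r); first exact: decr_run.
      have := set_run b (1, b, 1) (upd c3 b.+1 r).
      by rewrite /ev /= mul1n addn1 upd_neq //; lia.
    - by rewrite upd_eq b3 ck.
    - by move=> x xb; rewrite !(upd_lt _ _ _ xb) // fr3.
  have [c2 [[c1 h1 h2] ck fr2]] := loop y (leqnn _).
  rewrite -ck in fy; have [c3 [h3 e3 b3 fr3]] := call _ _ fr2 fy.
  exists (upd c3 o (ev (1, b, 0) c3)); last by rewrite upd_eq /ev /= mul1n addn0 b3.
  exists c1 => //; exists c2 => //; exists c3 => //; exists c3; last exact: set_run.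
  exact: test0_run.
Qed.

(** * Stack machines for register programs *)

Arguments cpair : simpl never.

(** The successor keeps codes positive: as digits of a stack they are then distinct from 0, the
    empty stack. *)
Fixpoint cmd_code (p : cmd) : nat :=
  match p with
  | Atom a => (cpair 0 (pickle a)).+1
  | Seq p q => (cpair 1 (cpair (cmd_code p) (cmd_code q))).+1
  | Star p => (cpair 2 (cmd_code p)).+1
  end.

Lemma cmd_code_inj : injective cmd_code.
Proof.
elim=> [a|p IHp q IHq|p IHp] [a'|p' q'|p'] /= /succn_inj /cpair_inj[//].
- by move=> _ /(pcan_inj pickleK) ->.
- by move=> _ /cpair_inj[/IHp -> /IHq ->].
- by move=> _ /IHp ->.
Qed.

Lemma cmd_code_gt0 p : 0 < cmd_code p.
Proof. by case: p. Qed.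

HB.instance Definition _ := Equality.copy cmd (inj_type cmd_code_inj).

(** These are the commands that can appear on a stack started with [p]; being finitely many, they
    yield finitely many rules. *)
Fixpoint subs (p : cmd) : seq cmd :=
  p :: match p with
       | Atom _ => [::]
       | Seq p1 p2 => subs p1 ++ subs p2
       | Star p1 => subs p1
       end.

Lemma subs_refl p : p \in subs p.
Proof. by case: p => *; rewrite inE eqxx. Qed.

Lemma subs_trans p q r : p \in subs q -> q \in subs r -> p \in subs r.
Proof.
move=> pq; elim: r => [a|r1 IH1 r2 IH2|r1 IH1].
- by rewrite {1}/subs mem_seq1 => /eqP qE; rewrite qE in pq.
- have [<-//|ne] := eqVneq q (Seq r1 r2); rewrite /= !in_cons (negbTE ne) !mem_cat /=.
  by case/orP=> [/IH1|/IH2] ->; rewrite ?orbT.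
have [<-//|ne] := eqVneq q (Star r1); rewrite /= !in_cons (negbTE ne) /=.
by move/IH1 ->; rewrite orbT.
Qed.

Lemma leq_sum_mem (T : eqType) (F : T -> nat) s x : x \in s -> F x <= \sum_(y <- s) F y.
Proof. by move=> xs; rewrite (big_rem x) //= leq_addr. Qed.

Section StackMachine.

Variable prog : cmd.

Definition base := (\sum_(p <- subs prog) cmd_code p).+1.

Definition stack (l : seq cmd) := foldr (fun p s => base * s + cmd_code p) 0 l.

(* The rule [(k, (A, b), a)] pops the digit [k] off a stack [base * s + k], leaving
   the stack [A * s + b], and performs the atom [a]. *)
Definition rule : Type := (nat * (nat * nat) * atom)%type.

Definition skip : atom := (0, (1, 0, 0), (1, 0, 0)).

Definition push2 (p q : cmd) := (base * base, base * cmd_code q + cmd_code p).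

(** The two rules of [Star] pop the same digit: one leaves the loop, the other unrolls it once. *)
Definition rules_of (p : cmd) : seq rule :=
  match p with
  | Atom a => [:: (cmd_code p, (1, 0), a)]
  | Seq p1 p2 => [:: (cmd_code p, push2 p1 p2, skip)]
  | Star p1 => [:: (cmd_code p, (1, 0), skip); (cmd_code p, push2 p1 p, skip)]
  end.

Definition rules := flatten [seq rules_of p | p <- subs prog].

Definition rule_at i := nth (0, (0, 0), skip) rules i.

Definition shift (p : form) : form := (p.1.1, p.1.2.+1, p.2).

(** Register 0 of the machine holds the stack, and register [x.+1] holds register [x] of the
    program. Parameter 0 stands for the rest of the stack. *)
Definition source (rl : rule) r : form :=
  if r is x.+1 then if x == rl.2.1.1 then shift rl.2.1.2 else (1, r, 0)
  else (base, 0, rl.1.1).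

Definition target (rl : rule) r : form :=
  if r is x.+1 then if x == rl.2.1.1 then shift rl.2.2 else (1, r, 0)
  else (rl.1.2.1, 0, rl.1.2.2).

Definition regs :=
  (\sum_(rl <- rules) (rl.2.1.1 + rl.2.1.2.1.2 + rl.2.2.1.2)).+2.

Lemma regs_bound rl : rl \in rules ->
  [/\ rl.2.1.1.+1 < regs, rl.2.1.2.1.2.+1 < regs & rl.2.2.1.2.+1 < regs].
Proof.
move=> /(leq_sum_mem (fun rl : rule => rl.2.1.1 + rl.2.1.2.1.2 + rl.2.2.1.2)).
rewrite /regs; move: (\sum_(_ <- _) _) rl.2.1.1 rl.2.1.2.1.2 rl.2.2.1.2 => s x y z le.
by split; lia.
Qed.

Lemma rule_vars i r : i < size rules -> r < regs ->
  (source (rule_at i) r).1.2 < regs /\ (target (rule_at i) r).1.2 < regs.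
Proof.
move=> iK rR; have [h1 h2 h3] := regs_bound (mem_nth (0, (0, 0), skip) iK).
by case: r rR => [|x] //= rR; rewrite /rule_at; case: eqP.
Qed.

Definition mstep := lstep regs (fun i => source (rule_at i)) (fun i => target (rule_at i)).
Definition mpath := lpath (size rules) regs
  (fun i => source (rule_at i)) (fun i => target (rule_at i)).

Definition agree (env c : nat -> nat) := forall x, x.+1 < regs -> c x.+1 = env x.

Lemma code_lt_base p : p \in subs prog -> cmd_code p < base.
Proof. by move=> h; rewrite ltnS; apply: leq_sum_mem. Qed.

(** Digits below [base] are unique and codes are positive and injective, so a rule applies only when
    its digit is the code of the top command, and never to the empty stack. *)
Lemma mstep_inv l env c i c1 : {subset l <= subs prog} ->
  c 0 = stack l -> agree env c -> i < size rules -> mstep i c c1 ->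
  exists p s A b a env', [/\ l = p :: s, (cmd_code p, (A, b), a) \in rules_of p,
    c1 0 = A * stack s + b, arel a env env' & agree env' c1].
Proof.
move=> ls c0 ag iK [d hd].
have rin := mem_nth (0, (0, 0), skip) iK; rewrite -/(rule_at i) in rin.
case: (rule_at i) rin hd => [[k [A b]] a] rin hd.
have [ra pa qa] := regs_bound rin.
have /flattenP[_ /mapP[p' p's ->] rp] := rin.
have kE : k = cmd_code p'.
  by case: (p') rp => [?|? ?|?]; rewrite ?inE; [| |case/orP] => /eqP[].
have [/= c0d c1d] := hd 0 isT.
case: l c0 ls => [|p s] c0 ls.
  by have := cmd_code_gt0 p'; rewrite c0 kE /ev /= in c0d; lia.
have pp := ls p (mem_head _ _).
have [ks sd] : cmd_code p = k /\ stack s = d 0.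
  apply: (@low_digit base) => //; first exact: code_lt_base.
    by rewrite kE; apply: code_lt_base.
  by move: c0; rewrite c0d /ev /= ![_ + base * _]addnC.
have {p's} pE : p = p' by apply: cmd_code_inj; rewrite ks.
rewrite -pE -ks in rp.
(* The machine has only [regs] registers; beyond them the parameters are completed by [env], which
   the atom leaves unchanged there. *)
pose D x := if x.+1 < regs then d x.+1 else env x.
pose env' x := if x == a.1.1 then ev a.2 D else D x.
exists p, s, A, b, a, env'; split=> //; first by rewrite c1d sd.
- exists D; rewrite /env' eqxx; split=> //.
    move=> x xa; rewrite (negbTE xa); split=> //; rewrite /D; case: ifP => // xR.
    rewrite -(ag x xR); have [-> _] := hd _ xR.
    by rewrite /= (negbTE xa) /ev /= mul1n addn0.
  rewrite -(ag _ ra); have [-> _] := hd _ ra.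
  by rewrite /= eqxx /ev /D /= pa.
- move=> x xR; have [_ ->] := hd _ xR; rewrite /env' /=.
  by case: eqP => _; rewrite /ev /D /= ?qa // xR mul1n addn0.
Qed.

Lemma mstep_intro p A b a env env' s c : p \in subs prog ->
  (cmd_code p, (A, b), a) \in rules_of p ->
  c 0 = base * s + cmd_code p -> agree env c -> arel a env env' ->
  exists c1, [/\ exists2 i, i < size rules & mstep i c c1,
    c1 0 = A * s + b & agree env' c1].
Proof.
move=> ps rp c0 ag [D [hx hp hq]].
pose rl : rule := (cmd_code p, (A, b), a).
have rin : rl \in rules by apply/flattenP; exists (rules_of p) => //; apply: map_f.
pose d r := if r is x.+1 then D x else s.
exists (fun r => ev (target rl r) d); split=> //.
  exists (index rl rules); rewrite ?index_mem // /mstep; exists d => r rR.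
  rewrite /rule_at nth_index //; split=> //.
  case: r rR => [|x] xR /=; first by rewrite c0.
  rewrite ag //; case: eqP => [->|/eqP/hx[-> _]]; first by rewrite hp.
  by rewrite /ev /= mul1n addn0.
move=> x _ /=; case: eqP => [->|/eqP/hx[_ ->]]; first by rewrite hq.
by rewrite /ev /= mul1n addn0.
Qed.

Fixpoint run_all (l : seq cmd) (env env' : nat -> nat) : Prop :=
  if l is p :: s then exists2 e, run p env e & run_all s e env' else env =1 env'.

Lemma arel_skip env env' : arel skip env env' -> env' =1 env.
Proof.
move=> /(@run_set 0 (1, 0, 0)) h x; rewrite h /upd /ev /= mul1n addn0.
by case: eqP => [->|].
Qed.

Lemma skip_arel env : arel skip env env.
Proof.
by exists env; rewrite /= /ev /= mul1n addn0.
Qed.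

(** The stack lists the commands still to be executed, so induction on [T] rebuilds their joint run;
    a final stack equal to 0 means that none is left. *)
Lemma mpath_run T l env c c' : {subset l <= subs prog} ->
  c 0 = stack l -> agree env c -> mpath T c c' -> c' 0 = 0 ->
  exists env', run_all l env env'.
Proof.
rewrite /mpath; elim: T l env c => [|T IHT] l env c ls c0 ag /=.
  move=> h c'0; move: c0; rewrite (h 0) // c'0.
  case: l {ls} => [_|p s /=]; first by exists env.
  by have := cmd_code_gt0 p; lia.
move=> [i [iK [c1 st pt]]] c'0.
have [p [s [A [b [a [e [lE rp c10 ar ag1]]]]]]] := mstep_inv ls c0 ag iK st.
subst l; have pp : p \in subs prog by apply: ls; rewrite mem_head.
have ss : {subset s <= subs prog} by move=> x xs; apply: ls; rewrite inE xs orbT.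
have sub_p q : q \in subs p -> q \in subs prog by move=> h; exact: subs_trans pp.
have sk : a = skip -> agree env c1.
  by move=> aE; rewrite aE in ar; move=> x xR; rewrite ag1 // (arel_skip ar).
case: p rp sub_p {ls c0 st} pp => [a'|p1 p2|p1] /= rp sub_p pp.
- move: rp; rewrite inE => /eqP[AE bE aE]; subst A b a'.
  have [|e' h] := IHT s e c1 ss _ ag1 pt c'0; first by rewrite c10 mul1n addn0.
  by exists e', e.
- move: rp; rewrite inE => /eqP[AE bE aE]; subst A b.
  have [| |e' /= [e1 h1 [e2 h2 h3]]] := IHT [:: p1, p2 & s] env c1 _ _ (sk aE) pt c'0.
  + move=> x; rewrite !inE => /or3P[/eqP->|/eqP->|/ss//]; apply: sub_p;
      by rewrite inE mem_cat subs_refl ?orbT.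
  + by rewrite c10 /=; lia.
  by exists e', e2 => //; exists e1.
- move: rp; rewrite !inE => /orP[] /eqP[AE bE aE]; subst A b.
    have [|e' h] := IHT s env c1 ss _ (sk aE) pt c'0; first by rewrite c10 mul1n addn0.
    by exists e', env => //; exact: star_refl.
  have [| |e' /= [e1 h1 [e2 h2 h3]]] := IHT [:: p1, Star p1 & s] env c1 _ _ (sk aE) pt c'0.
  + move=> x; rewrite !inE => /or3P[/eqP->|/eqP->|/ss//]; apply: sub_p.
      by rewrite inE subs_refl orbT.
    by rewrite inE eqxx.
  + by rewrite c10 /=; lia.
  by exists e', e2 => //; apply: star_step h1 h2.
Qed.

Definition mreach := star (fun c c' => exists2 i, i < size rules & mstep i c c').

(** The rest of the stack is an arbitrary number [s], never inspected while [p] runs; this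
    generality is what the induction on [p] needs. *)
Lemma run_mreach p env env' s c : p \in subs prog -> run p env env' ->
  c 0 = base * s + cmd_code p -> agree env c ->
  exists c1, [/\ mreach c c1, c1 0 = s & agree env' c1].
Proof.
elim: p env env' s c => [a|p1 IH1 p2 IH2|p1 IH1] env env' s c pp /=.
- move=> ar c0 ag.
  have [|c1 [st c10 ag1]] := mstep_intro (A := 1) (b := 0) (a := a) pp _ c0 ag ar.
    by rewrite inE.
  exists c1; split=> //; last by rewrite c10 mul1n addn0.
  by apply: star_step st _; exact: star_refl.
- move=> [e h1 h2] c0 ag.
  have [|c1 [st c10 ag1]] := mstep_intro (A := base * base)
      (b := base * cmd_code p2 + cmd_code p1) pp _ c0 ag (skip_arel env).
    by rewrite inE.
  have [||c2 [st2 c20 ag2]] := IH1 _ _ (base * s + cmd_code p2) _ _ h1 _ ag1.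
  + by apply: subs_trans pp; rewrite inE mem_cat subs_refl orbT.
  + by rewrite c10; lia.
  have [|c3 [st3 c30 ag3]] := IH2 _ _ s _ _ h2 c20 ag2.
    by apply: subs_trans pp; rewrite inE mem_cat subs_refl !orbT.
  by exists c3; split=> //; apply: star_step st _; apply: star_trans st2 st3.
- move=> h; elim: h c => {env env'} [env|env e env' h1 _ IH] c c0 ag.
    have [|c1 [st c10 ag1]] := mstep_intro (A := 1) (b := 0) pp _ c0 ag (skip_arel env).
      by rewrite inE eqxx.
    exists c1; split=> //; last by rewrite c10 mul1n addn0.
    by apply: star_step st _; exact: star_refl.
  have [|c1 [st c10 ag1]] := mstep_intro (A := base * base)
      (b := base * cmd_code (Star p1) + cmd_code p1) pp _ c0 ag (skip_arel env).
    by rewrite !inE eqxx orbT.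
  have [||c2 [st2 c20 ag2]] := IH1 _ _ (base * s + cmd_code (Star p1)) _ _ h1 _ ag1.
  + by apply: subs_trans pp; rewrite inE subs_refl orbT.
  + by rewrite c10; lia.
  have [c3 [st3 c30 ag3]] := IH _ c20 ag2.
  by exists c3; split=> //; apply: star_step st _; apply: star_trans st2 st3.
Qed.

Lemma mreach_mpath c c' : mreach c c' -> exists T, mpath T c c'.
Proof.
elim=> [{}c|{}c c1 {}c' [i iK st] _ [T h]]; first by exists 0.
by exists T.+1, i; split=> //; exists c1.
Qed.

Lemma run_machine env :
  (exists env', run prog env env') <->
  exists T c', mpath T (fun r => if r is x.+1 then env x else cmd_code prog) c' /\ c' 0 = 0.
Proof.
pose c r := if r is x.+1 then env x else cmd_code prog; rewrite -/c; split.
  move=> [env' h].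
  have [||c1 [st c10 _]] := @run_mreach _ _ _ 0 c (subs_refl prog) h.
  + by rewrite muln0.
  + by [].
  by have [T p] := mreach_mpath st; exists T, c1.
move=> [T [c' [p c'0]]].
have [//| |//|env' /= [e h _]] := @mpath_run T [:: prog] env _ _ _ _ _ p c'0.
- by move=> x; rewrite inE => /eqP ->; exact: subs_refl.
- by rewrite /= muln0.
by exists e.
Qed.

End StackMachine.

Lemma recfun_program (f : recfun 1) : exists prog, forall n,
  reval f [tuple n] 0 <-> exists env', run prog (fun x => if x is 0 then n else 0) env'.
Proof.
(* Register 0 is the input, 1 the output, and scratch space starts at 2; the final test discards the
   runs with a nonzero value. *)
exists (Seq (compile f [tuple 0] 1 2) (test0 1)) => n.
pose env x := if x is 0 then n else 0; rewrite -/env.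
have ab : {in [tuple 0], forall x, x < 2} by move=> x; rewrite inE => /eqP ->.
have <- : map_tuple env [tuple 0] = [tuple n] by apply: val_inj.
split.
  move=> /(compile_complete (o := 1) ab isT)[c1 h1 e1].
  by exists c1, c1 => //; exact: test0_run.
move=> [c2 [c1 h1 /run_test0[e _]]].
by have [_] := compile_sound (o := 1) ab isT h1; rewrite e.
Qed.

(** * Relations definable by terms *)

Definition termf (F : (nat -> nat) -> nat) := exists t, forall env, aeval env t = F env.

Definition termp (P : (nat -> nat) -> Prop) :=
  exists t, forall env, aeval env t = 0 <-> P env.

Lemma termf_var i : termf (fun env => env i).
Proof. by exists (Var i). Qed.

Lemma termf_cst c : termf (fun=> c).
Proof. by exists (Cst c). Qed.

Lemma termf_bin o F G : termf F -> termf G -> termf (fun env => aop_eval o (F env) (G env)).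
Proof. by move=> [t tE] [u uE]; exists (Bin o t u) => env /=; rewrite tE uE. Qed.

Lemma termf_add F G : termf F -> termf G -> termf (fun env => F env + G env).
Proof. exact (@termf_bin Add F G). Qed.
Lemma termf_sub F G : termf F -> termf G -> termf (fun env => F env - G env).
Proof. exact (@termf_bin Defs.Sub F G). Qed.
Lemma termf_mul F G : termf F -> termf G -> termf (fun env => F env * G env).
Proof. exact (@termf_bin Mul F G). Qed.
Lemma termf_div F G : termf F -> termf G -> termf (fun env => F env %/ G env).
Proof. exact (@termf_bin Div F G). Qed.
Lemma termf_mod F G : termf F -> termf G -> termf (fun env => F env %% G env).
Proof. exact (@termf_bin Mod F G). Qed.
Lemma termf_exp F G : termf F -> termf G -> termf (fun env => F env ^ G env).
Proof. exact (@termf_bin Pow F G). Qed.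

Lemma eq_termf F G : F =1 G -> termf F -> termf G.
Proof. by move=> FG [t tE]; exists t => env; rewrite tE FG. Qed.

Lemma eq_termp P Q : (forall env, P env <-> Q env) -> termp P -> termp Q.
Proof. by move=> PQ [t tE]; exists t => env; rewrite -PQ. Qed.

Lemma termf_succ F : termf F -> termf (fun env => (F env).+1).
Proof.
move=> hF; apply: eq_termf (termf_add (termf_cst 1) hF) => env; exact: add1n.
Qed.

Lemma termf_sum n (F : nat -> (nat -> nat) -> nat) :
  (forall i, termf (F i)) -> termf (fun env => \sum_(i < n) F i env).
Proof.
move=> hF; elim: n => [|n IHn].
  by apply: eq_termf (termf_cst 0) => env; rewrite big_ord0.
by apply: eq_termf (termf_add IHn (hF n)) => env; rewrite big_ord_recr.
Qed.

Lemma termp_eq F G : termf F -> termf G -> termp (fun env => F env = G env).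
Proof.
move=> hF hG; have [t tE] := termf_add (termf_sub hF hG) (termf_sub hG hF).
by exists t => env; rewrite tE; lia.
Qed.

Lemma termp_lt F G : termf F -> termf G -> termp (fun env => F env < G env).
Proof.
move=> hF hG; have [t tE] := termf_sub (termf_succ hF) hG.
by exists t => env; rewrite tE; lia.
Qed.

Lemma termp_and P Q : termp P -> termp Q -> termp (fun env => P env /\ Q env).
Proof.
move=> [t tE] [u uE]; exists (Bin Add t u) => env /=; rewrite -tE -uE; lia.
Qed.

(** For a fixed [n] the quantifier is a finite conjunction. *)
Lemma termp_all n (P : nat -> (nat -> nat) -> Prop) :
  (forall i, termp (P i)) -> termp (fun env => forall i, i < n -> P i env).
Proof.
move=> hP; elim: n => [|n IHn].
  by exists (Cst 0) => env; split.
apply: eq_termp (termp_and IHn (hP n)) => env; split.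
  by move=> [h hn] i; rewrite ltnS leq_eqVlt => /predU1P[->//|/h].
by move=> h; split=> [i lt|]; apply: h => //; exact: ltnW.
Qed.

Lemma termp_bitsub F G : termf F -> termf G -> termp (fun env => bitsub (F env) (G env)).
Proof.
move=> hF hG.
have hY := termf_exp (termf_cst 2) (termf_succ hG).
have := termp_eq (termf_mod (termf_div (termf_exp (termf_succ hY) hG) (termf_exp hY hF))
  (termf_cst 2)) (termf_cst 1).
apply: eq_termp => env; rewrite parity_binE /bitsub.
by case: (odd _).
Qed.

Lemma termf_lg F : termf F -> termf (fun env => lg (F env)).
Proof.
move=> hF; have hq := termf_sub (termf_exp (termf_cst 2) hF) (termf_cst 1).
apply: (termf_div _ hq); apply: termf_sub (termf_cst 1).
by apply: termf_mod (termf_exp hq (termf_cst 2)); exact: termf_exp.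
Qed.

Lemma termf_pow2part F : termf F -> termf (fun env => pow2part (F env)).
Proof.
move=> hF; apply: (termf_mod _ hF).
by apply: termf_exp; [exact: termf_cst | exact: termf_exp].
Qed.

Lemma termf_fst_arg F : termf F -> termf (fun env => fst_arg (F env)).
Proof.
move=> hF; apply: termf_lg; apply: termf_div => //.
by apply: termf_sub (termf_cst 1); exact: termf_pow2part.
Qed.

Lemma termf_left_arg F : termf F -> termf (fun env => left_arg (F env)).
Proof. by move=> hF; apply: termf_sub (termf_cst 1); exact: termf_fst_arg. Qed.

Lemma termf_right_arg F : termf F -> termf (fun env => right_arg (F env)).
Proof.
move=> hF; apply: termf_sub; last exact: termf_fst_arg.
by do 2 apply: termf_lg; exact: termf_pow2part.
Qed.

Lemma termf_cpair F G : termf F -> termf G -> termf (fun env => cpair (F env) (G env)).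
Proof.
move=> hF hG; have hs := termf_add hF hG; apply: (termf_add _ hG).
apply: eq_termf (termf_div (termf_mul hs (termf_succ hs)) (termf_cst 2)) => env.
by rewrite divn2.
Qed.

(** * Substitution and the reduction to a single variable *)

Fixpoint asubst (sigma : nat -> aterm) (t : aterm) : aterm :=
  match t with
  | Var i => sigma i
  | Cst c => Cst c
  | Bin o a b => Bin o (asubst sigma a) (asubst sigma b)
  end.

Lemma aeval_asubst env sigma t :
  aeval env (asubst sigma t) = aeval (fun i => aeval env (sigma i)) t.
Proof. by elim: t => //= o a -> b ->. Qed.

Lemma eq_aeval env env' t : env =1 env' -> aeval env t = aeval env' t.
Proof. by move=> h; elim: t => //= o a -> b ->. Qed.

Lemma eq_in_aeval env env' t : {in avars t, env =1 env'} -> aeval env t = aeval env' t.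
Proof.
elim: t => //= [i|o a IHa b IHb] h; first by apply: h; rewrite inE.
by rewrite IHa ?IHb // => i hi; apply: h; rewrite mem_cat hi ?orbT.
Qed.

Definition collapse := asubst (fun=> Var 0).

Lemma aeval1_collapse t m : aeval1 (collapse t) m = aeval1 t m.
Proof. exact: aeval_asubst. Qed.

Lemma avars_collapse t : all (pred1 0) (avars (collapse t)).
Proof. by elim: t => //= o a ha b hb; rewrite all_cat ha. Qed.

Lemma univariate_all t : all (pred1 0) (avars t) -> univariate t.
Proof.
move=> /allP h; rewrite /univariate -[1]/(size [:: 0]).
apply: uniq_leq_size (undup_uniq _) _ => i; rewrite mem_undup => /h /eqP ->.
by rewrite inE.
Qed.

Definition component j m := left_arg (iter j right_arg m).

Lemma component_surj N (env : nat -> nat) :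
  exists m, forall j, j < N -> component j m = env j.
Proof.
elim: N env => [|N IHN] env; first by exists 0.
have [m' h'] := IHN (fun j => env j.+1).
have [m [h1 h2]] := args_surj (env 0) m'.
exists m => -[|j] lt; first exact: h1.
by rewrite /component iterSr h2; apply: h'.
Qed.

(** Variable [j > 0] becomes component [j] of the single variable, and variable 0 becomes [G] of
    component 0, which is [left_arg]. The condition [left_arg m = k] stays outside [t], so that [t]
    does not depend on [k]. *)
Lemma one_variable (P : (nat -> nat) -> Prop) (G : nat -> nat) :
  termp P -> termf (fun env => G (env 0)) ->
  exists t, all (pred1 0) (avars t) /\ forall k,
    (exists m, left_arg m = k /\ aeval1 t m = 0) <->
    (exists env, env 0 = G k /\ P env).
Proof.
move=> [t tE] [g gE].
have [l lE] := termf_left_arg (termf_var 0); have [r rE] := termf_right_arg (termf_var 0).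
pose comp j := asubst (fun=> iter j (fun u => asubst (fun=> u) r) (Var 0)) l.
have compE j env : aeval env (comp j) = component j (env 0).
  rewrite aeval_asubst lE /component; congr left_arg.
  by elim: j => //= j <-; rewrite aeval_asubst rE.
pose sigma j := if j is 0 then asubst (fun=> comp 0) g else comp j.
exists (collapse (asubst sigma t)); split; first exact: avars_collapse.
have evE m : aeval1 (collapse (asubst sigma t)) m =
    aeval (fun j => if j is 0 then G (left_arg m) else component j m) t.
  rewrite aeval1_collapse /aeval1 aeval_asubst; apply: eq_aeval => -[|j] /=.
    by rewrite aeval_asubst gE compE.
  by rewrite compE.
move=> k; split.
  move=> [m [mk]]; rewrite evE mk => /tE h.
  by exists (fun j => if j is 0 then G k else component j m).
move=> [env [e0 /tE h]].
(* The sum of the indices, plus one, exceeds every index occurring in [t], so enough components are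
   prescribed. *)
have [m hm] := component_surj (\sum_(i <- avars t) i).+1 (fun j => if j is 0 then k else env j).
have mk : left_arg m = k by exact: (hm 0).
exists m; split=> //; rewrite evE mk -h; apply: eq_in_aeval => -[|j] hj; first by rewrite e0.
by rewrite hm // ltnS; apply: (leq_sum_mem id).
Qed.

(** Layout of the unknowns: three scalars, then the [R] final register values, then for each rule
    [i] a row of length [R.+1] made of [S i] and its parameters. *)
Lemma flat_env R n T e (c : nat -> nat) (S : nat -> nat) (V : nat -> nat -> nat) :
  exists env, [/\ env 0 = n, env 1 = T, env 2 = e,
    forall r, r < R -> env (3 + r) = c r
    & (forall i, env (3 + (R + i * R.+1)) = S i) /\
      forall i j, j < R -> env (3 + (R + (i * R.+1 + j.+1))) = V i j].
Proof.
pose aux y := if y < R then c y else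
  if (y - R) %% R.+1 is j.+1 then V ((y - R) %/ R.+1) j else S ((y - R) %/ R.+1).
exists (fun x => match x with 0 => n | 1 => T | 2 => e | y.+3 => aux y end).
split=> // [r rR|]; first by rewrite -[LHS]/(aux r) /aux rR.
split=> [i|i j jR].
  by rewrite -[LHS]/(aux _) /aux ltnNge leq_addr addKn modnMl mulnK.
rewrite -[LHS]/(aux _) /aux ltnNge leq_addr addKn modnMDl modn_small //.
by rewrite divnMDl // divn_small // addn0.
Qed.

(** All unknowns of a trace become coordinates of [env], which merges the existential quantifiers
    into one and leaves clauses that are conditions on terms. *)
Lemma recfun_termp (f : recfun 1) : exists P, termp P /\
  forall n, reval f [tuple n] 0 <-> exists env, env 0 = n /\ P env.
Proof.
have [prog progE] := recfun_program f.
pose K := size (rules prog); pose R := regs prog.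
pose src i := source prog (rule_at prog i); pose dst i := target (rule_at prog i).
pose w := width K R src dst.
(* Machine register 1, which is program register 0, holds the input; the stack holds the program
   alone. *)
pose init n r := if r is r'.+1 then (if r' is 0 then n else 0) else cmd_code prog.
pose S (env : nat -> nat) i := env (3 + (R + i * R.+1)).
pose V (env : nat -> nat) i j := env (3 + (R + (i * R.+1 + j.+1))).
pose P env := traces K R src dst (2 ^ (env 2 + w)) (env 2) (env 1) (init (env 0))
  (fun r => env (3 + r)) (S env) (V env) /\ env 3 = 0.
exists P; split; last first.
  move=> n; rewrite progE run_machine.
  split.
    move=> [T [c' [/(@ex_intro _ _ T) /reach_traces]]].
    case=> [|{}T [e [S' [V' h]]] c'0]; first exact: rule_vars.
    have [env [e0 e1 e2 cE [SE VE]]] := flat_env R n T e c' S' V'.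
    exists env; split=> //; split; last by rewrite (cE 0).
    rewrite e0 e1 e2.
    case: h => h1 h2 h3 h4 h5.
    (* [env] stores only the parameters of index below [R], and the forms of the rules use no
       others. *)
    have linE phi r : (forall i, i < K -> (phi i r).1.2 < R) ->
        lin K phi (S env) (V env) r = lin K phi S' V' r.
      by move=> hphi; apply: (eq_lin hphi) => [i _|i j _]; [exact: SE | exact: VE].
    split=> //.
    - by rewrite -h1; apply: eq_bigr => i _; exact: SE.
    - by move=> i iK; rewrite /S SE; exact: h2.
    - by move=> i j iK jR; rewrite /S /V SE VE //; exact: h3.
    - move=> r rR; rewrite !linE ?cE; first exact: h5.
      + by [].
      + by move=> i iK; have [] := rule_vars iK rR.
      + by move=> i iK; have [] := rule_vars iK rR.
  move=> [env [<- [h e3]]].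
  have /reach_traces[|T p] : exists T e S V,
      traces K R src dst (2 ^ (e + w)) e T (init (env 0)) (fun r => env (3 + r)) S V.
    by exists (env 1), (env 2), (S env), (V env).
    exact: rule_vars.
  by exists T, (fun r => env (3 + r)).
have v i := termf_var i.
have hX : termf (fun env => 2 ^ (env 2 + w)).
  by apply: termf_exp (termf_cst 2) _; apply: termf_add (v 2) (termf_cst w).
have hU : termf (fun env => repunit (2 ^ (env 2 + w)) (env 1)).
  apply: eq_termf (termf_div (termf_sub (termf_exp hX (v 1)) (termf_cst 1))
    (termf_sub hX (termf_cst 1))) => env.
  by rewrite repunitE //; exact: base_gt1.
have hlin phi r : termf (fun env => lin K phi (S env) (V env) r).
  apply: (termf_sum K (F := fun i env =>
    (phi i r).1.1 * V env i (phi i r).1.2 + (phi i r).2 * S env i)) => i.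
  by apply: termf_add; apply: termf_mul (termf_cst _) (v _).
have hinit r : termf (fun env => init (env 0) r).
  by case: r => [|[|r]]; [exact: termf_cst | exact: v | exact: termf_cst].
have hS i : termf (fun env => S env i) by exact: v.
apply: (termp_and _ (termp_eq (v 3) (termf_cst 0))).
have h1 : termp (fun env => \sum_(i < K) S env i = repunit (2 ^ (env 2 + w)) (env 1)).
  exact: (termp_eq (termf_sum K hS) hU).
have h2 := termp_all K (fun i => termp_bitsub (hS i) hU).
have h3 := termp_all K (fun i => termp_all R (fun j =>
  termp_bitsub (v _ : termf (fun env => V env i j))
   (termf_mul (termf_sub (termf_exp (termf_cst 2) (v 2)) (termf_cst 1)) (hS i)))).
have h4 := termp_all R (fun r => termp_lt (hinit r) hX).
have h5 := termp_all R (fun r => termp_eq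
  (termf_add (termf_mul hX (hlin dst r)) (hinit r))
  (termf_add (hlin src r) (termf_mul (termf_exp hX (v 1)) (v (3 + r))))).
apply: eq_termp (termp_and h1 (termp_and h2 (termp_and h3 (termp_and h4 h5)))) => env.
split=> [[? [? [h [? ?]]]]|[? ? h ? ?]]; split=> //; first by move=> i j iK; exact: h.
by split=> //; split=> // i iK j; exact: h.
Qed.

(** * The diagonal term and the contradiction *)

Definition tag l k t := Bin Add t (Bin Add (Bin Defs.Sub l (Cst k)) (Bin Defs.Sub (Cst k) l)).

Theorem theorem1 :
  ~ algorithmically_solvable aterm_code (fun t : aterm => univariate t)
      (fun t : aterm => exists m : nat, aeval1 t m = 0).
Proof.
move=> [f hf].
have [l0 l0E] := termf_left_arg (termf_var 0); pose l := collapse l0.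
have lE m : aeval1 l m = left_arg m by rewrite aeval1_collapse /aeval1 l0E.
(* [G k] is the code of [tag l k t] when [t] has code [k]: the first [k] is the code of [t], and
   each [cpair 1 k] encodes the constant [k]. *)
pose G k := cpair 2 (cpair k (cpair 2 (cpair
  (cpair 3 (cpair (aterm_code l) (cpair 1 k))) (cpair 3 (cpair (cpair 1 k) (aterm_code l)))))).
have hG : termf (fun env => G (env 0)).
  have v := termf_var 0; have c := termf_cst; by repeat apply: termf_cpair.
have [P [hP fP]] := recfun_termp f.
have [t [tv tP]] := one_variable hP hG.
pose k := aterm_code t; pose u := tag l k t.
have uv : univariate u.
  by apply: univariate_all; rewrite /= !all_cat tv /= avars_collapse.
have uE m : aeval1 u m = 0 <-> left_arg m = k /\ aeval1 t m = 0.
  by rewrite /aeval1 /= -!/(aeval1 _ _) lE; lia.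
have [yes no] := hf u uv.
(* By the choice of [t], [f] returns 0 at [G k] exactly when some [m] satisfies [left_arg m = k] and
   [aeval1 t m = 0], that is, when [u] has a zero; a correct [f] would then return 1. *)
have zero : reval f [tuple aterm_code u] 0 <-> exists m, aeval1 u m = 0.
  rewrite fP -[aterm_code u]/(G k) -tP.
  by split=> -[m /uE h]; exists m.
have nz : ~ exists m, aeval1 u m = 0.
  by move=> h; have := reval_functional (yes h) (zero.2 h).
exact/nz/zero/no.
Qed.
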